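(* Let $X$ be a Hausdorff space. If $X$ is $\chi$-Lindelöf, then $|X|\le 2^{\chi(X)}$.
   Context: All spaces are assumed to be Hausdorff. The character $\chi(X)$ of a space $X$ is the smallest infinite cardinal $\kappa$ such that every point of $X$ has a local base of cardinality not exceeding $\kappa$. $[S]^{<\omega}$ denotes the collection of all finite subsets of $S$, and $\overline{B}$ denotes the closure of $B$ in $X$. ''Countable'' means of cardinality at most $\omega$. For a cardinal $\kappa$, a $\kappa$-net in $X$ is an indexed family $\xi=\{x_F:F\in[\kappa]^{<\omega}\}$ of points of $X$ (indexed by the finite subsets of $\kappa$; repetitions allowed). We write $\xi\subseteq A$ if $x_F\in A$ for all $F$. Let $A\subseteq X$ and let $\xi=\{x_F:F\in[\kappa]^{<\omega}\}\subseteq A$ be a $\kappa$-net. A point $x\in A$ is a $\theta$-cluster point of $\xi$ relative to $A$ if, for every open set $U$ of $X$ with $x\in U$ and every $\alpha<\kappa$, there exists $F\in[\kappa]^{<\omega}$ such that $\alpha\in F$ and $x_F\in\overline{U\cap A}$. If $A=X$, we say that $x$ is a $\theta$-cluster point of $\xi$ (in $X$). A set $A\subseteq X$ is $\chi$-net-closed if for every $\chi(X)$-net $\xi=\{x_F:F\in[\chi(X)]^{<\omega}\}\subseteq A$: if $\xi$ has a $\theta$-cluster point in $X$, then $\xi$ has a $\theta$-cluster point in $A$ relative to $A$. A space $X$ is $\chi$-Lindelöf if for every $\chi$-net-closed set $A\subseteq X$ and every collection $\mathcal{U}=\bigcup\{\mathcal{U}_\alpha:\alpha<\chi(X)\}$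 of open sets in $X$ which covers $A$ (presented as a union of subcollections $\mathcal{U}_\alpha$), there are countable subcollections $\mathcal{V}_\alpha\subseteq\mathcal{U}_\alpha$ for each $\alpha<\chi(X)$ such that $A\subseteq\bigcup\{\overline{\bigcup\mathcal{V}_\alpha}:\alpha<\chi(X)\}$. *)

(* Defs.v *)
From mathcomp Require Import all_boot all_order finmap.
From mathcomp Require Import all_classical topology.

Set Implicit Arguments.
Unset Strict Implicit.
Unset Printing Implicit Defensive.

Local Open Scope classical_set_scope.
Local Open Scope card_scope.

Definition local_base (X : topologicalType) (x : X) (B : set (set X)) : Prop :=
  B `<=` open_nbhs x /\
  (forall U : set X, nbhs x U -> exists2 V : set X, B V & V `<=` U).

(* A cardinal is represented by any type having that cardinality. *)
Definition bounds_character (X : topologicalType) (K : Type) : Prop :=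
  infinite_set [set: K] /\
  (forall x : X, exists2 B : set (set X), local_base x B & B #<= [set: K]).

Definition is_character (X : topologicalType) (K : Type) : Prop :=
  bounds_character X K /\
  (forall L : Type, bounds_character X L -> [set: K] #<= [set: L]).

Lemma card_leTT (A B : Type) :
  [set: A] #<= [set: B] <-> exists f : A -> B, injective f.
Proof.
split=> [/card_leP[f]|[f finj]]; last first.
  have /injfunPex[g] : exists2 f : A -> B,
      set_fun [set: A] [set: B] f & set_inj [set: A] f.
    by exists f => // x y _ _; exact: finj.
  exact: inj_card_le g.
exists (fun a => \val (f (SigSub (mem_set (I : [set: A] a))))) => a b /val_inj.
move=> eqf; have := @inj _ _ _ f _ _ _ _ eqf.
by rewrite !in_setT => /(_ isT isT) [].
Qed.

(* A nonempty family of cardinals has a least element; the argument extracts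
   it from a maximal partial system of injections between the types. *)
Lemma card_minimum (I : Type) (A : I -> Type) (i0 : I) :
  exists i, forall j, [set: A i] #<= [set: A j].
Proof.
pose P (Z : set (forall i, A i)) :=
  forall i z z', Z z -> Z z' -> z i = z' i -> z = z'.
have [F FP Ftot|Z [PZ Zmax]] := @Zorn_bigcup _ P.
  move=> i z z' [C FC Cz] [D FD Dz'].
  have [CD|DC] := Ftot _ _ FC FD.
    exact: (FP _ FD i z z' (CD _ Cz) Dz').
  exact: (FP _ FC i z z' Cz (DC _ Dz')).
have [i onto] : exists i, forall a : A i, exists2 z, Z z & z i = a.
  apply: contrapT => /forallNP notonto.
  have notontoP i : exists a : A i, forall z, Z z -> z i <> a.
    have /existsNP[a /forall2NP aZ] := notonto i.
    by exists a => z Zz; case: (aZ z).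
  pose a i := projT1 (cid (notontoP i)).
  have aZ i : forall z, Z z -> z i <> a i by rewrite /a; case: cid.
  apply: (Zmax (Z `|` [set a])).
    split; first exact: subsetUl.
    by move=> /(_ a (or_intror erefl)) Za; exact: aZ i0 _ Za erefl.
  move=> i z z' [Zz|->] [Zz'|->] // eqz.
  - exact: PZ eqz.
  - by case: (aZ _ _ Zz eqz).
  - by case: (aZ _ _ Zz' (esym eqz)).
exists i => j; apply/card_leTT.
have /choice[f fP] a : exists z, Z z /\ z i = a.
  by have [z Zz za] := onto a; exists z.
exists (fun a => f a j) => a b eqf.
have [Za <-] := fP a; have [Zb <-] := fP b.
by rewrite (PZ j _ _ Za Zb eqf).
Qed.

Lemma card_le_total (A B : Type) : [set: A] #<= [set: B] \/ [set: B] #<= [set: A].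
Proof.
have [[] min] := @card_minimum bool (fun b => if b then A else B) true.
  by left; exact: min false.
by right; exact: min true.
Qed.

Lemma bounds_character_le (X : topologicalType) (K L : Type) :
  bounds_character X K -> [set: K] #<= [set: L] -> bounds_character X L.
Proof.
move=> [infK baseK] KL; split.
  by apply/infiniteP; apply: card_le_trans KL; exact/infiniteP.
by move=> x; have [B Bx BK] := baseK x; exists B => //; exact: card_le_trans KL.
Qed.

Lemma bounds_character_sets (X : topologicalType) :
  bounds_character X (nat + set X).
Proof.
split.
  by apply/infiniteP/card_leTT; exists inl => m n [].
move=> x; exists (open_nbhs x).
  split=> // U; rewrite nbhsE => -[V ? ?]; by exists V.
apply: card_le_trans (card_leT _) _.
by apply/card_leTT; exists inr => U V [].
Qed.

Lemma character_exists (X : topologicalType) :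
  exists K : choiceType, is_character X K.
Proof.
pose T0 : Type := (nat + set X)%type.
pose Q (S : set T0) := bounds_character X S.
pose I := {S : set T0 | Q S}.
have bT : bounds_character X [set: T0].
  apply: bounds_character_le (@bounds_character_sets X) _.
  apply/card_leTT; exists (fun t => SigSub (mem_set (Logic.I : [set: T0] t))).
  by move=> s t [].
have [[S bS] Smin] :=
  @card_minimum I (fun S => set_type (proj1_sig S)) (exist Q _ bT).
exists {classic S}; split=> // L bL.
have [/card_leTT[f finj]|T0L] := card_le_total L T0.
  have bfL : bounds_character X (range f).
    apply: bounds_character_le bL _; apply/card_leTT.
    exists (fun l => SigSub (mem_set (imageT f l))) => k l.
    by move=> [/finj].
  apply: card_le_trans (Smin (exist Q _ bfL)) _ => /=.
  apply/card_leTT.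
  have /choice[g gP] (t : range f) : exists l, f l = \val t.
    by have [l _ <-] := set_mem (valP t); exists l.
  by exists g => s t eqg; apply: val_inj; rewrite -!gP eqg.
apply: card_le_trans (Smin (exist Q _ bT)) _.
apply: card_le_trans T0L; apply/card_leTT.
by exists \val; exact: val_inj.
Qed.

(* Only the cardinality of chi X is determined, by chiP; every notion below is
   invariant under bijections of the index type. *)
Definition chi (X : topologicalType) : choiceType :=
  projT1 (cid (character_exists X)).

Lemma chiP (X : topologicalType) : is_character X (chi X).
Proof. by rewrite /chi; case: cid. Qed.

(* The elements of K play the role of the ordinals below the cardinal; their
   order is never used. *)
Definition net (K : choiceType) (X : Type) : Type := {fset K} -> X.

Definition net_in (K : choiceType) (X : Type) (xi : net K X) (A : set X) : Prop :=
  forall F : {fset K}, A (xi F).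

Definition theta_cluster_point (X : topologicalType) (K : choiceType)
    (A : set X) (xi : net K X) (x : X) : Prop :=
  A x /\
  (forall U : set X, open U -> U x ->
     forall alpha : K, exists F : {fset K},
       alpha \in F /\ closure (U `&` A) (xi F)).

Definition chi_net_closed (X : topologicalType) (A : set X) : Prop :=
  forall xi : net (chi X) X, net_in xi A ->
    (exists x : X, theta_cluster_point [set: X] xi x) ->
    exists x : X, theta_cluster_point A xi x.

Definition chi_Lindelof (X : topologicalType) : Prop :=
  forall A : set X, chi_net_closed A ->
  forall U : chi X -> set (set X),
    (forall alpha : chi X, U alpha `<=` @open X) ->
    A `<=` \bigcup_alpha (\bigcup_(O in U alpha) O) ->
    exists V : chi X -> set (set X),
      (forall alpha : chi X, V alpha `<=` U alpha /\ countable (V alpha)) /\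
      A `<=` \bigcup_alpha closure (\bigcup_(O in V alpha) O).

(* Main.v *)
Require Import Defs.
From mathcomp Require Import all_boot all_order finmap.
From mathcomp Require Import all_classical topology.

Set Implicit Arguments.
Unset Strict Implicit.
Unset Printing Implicit Defensive.

Local Open Scope classical_set_scope.
Local Open Scope card_scope.

(** The bound comes from one set [A] of at most 2^kappa points, where kappa is
the character of [X], and the proof that [A] is everything.

Fix at each point a local base indexed by kappa.  The set [A] contains a given
point and answers demands that are posed by families of at most kappa points
of [A]:
- if a kappa-net in [A] has a theta-cluster point, [A] contains one;
- if basic neighbourhoods of two points of [A] meet, they meet in [A];
- if kappa many families of basic neighbourhoods of points of [A] are such
  that the closures of their unions do not cover [X], then [A] contains an
  uncovered point.

The first two make [A] chi-net-closed: the second one turns membership of a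
point of [A] in the closure of [U] into membership in the closure of
[U `&` A] ([chi_net_closed_of_meets]).  Suppose that some [q] lies outside
[A].  The Hausdorff axiom separates each point of [A] from [q] by a basic
neighbourhood missing some [N q alpha]; sorting these neighbourhoods by
[alpha] gives a cover to which the chi-Lindelof property applies, and the
subfamilies that it yields have unions whose closures cover [A] but not [q]
([basic_cover_missing]).  By the third kind of demand, [A] contains an
uncovered point, which is absurd.

Instead of a recursion of length kappa^+, the set [A] is the set of values of
the well-founded trees whose nodes carry a demand and have kappa many children
([small_closed_set]).  A tree is determined by the demands met along its finite
branches, and so there are at most 2^kappa trees ([tree_card_le]).  This count
rests on kappa * kappa = kappa for infinite kappa ([infinite_pairing]), which
is obtained from Zorn's lemma. *)

(** * Squares of infinite cardinals *)

Definition graph_field (K : Type) (Z : set (K * K * K)) : set K :=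
  [set a | exists c, Z (a, a, c)].

(** Graph of a relation whose inverse is a partial map from the field of [Z]
onto the square of that field.  Choosing one value per pair gives an
injection of the square into the field. *)
Definition pairing_graph (K : Type) (Z : set (K * K * K)) : Prop :=
  [/\ forall a b c, Z (a, b, c) ->
        [/\ graph_field Z a, graph_field Z b & graph_field Z c],
      forall a b, graph_field Z a -> graph_field Z b -> exists c, Z (a, b, c)
    & forall p q c, Z (p, c) -> Z (q, c) -> p = q].

Lemma graph_field_sub (K : Type) (Z Z' : set (K * K * K)) :
  Z `<=` Z' -> graph_field Z `<=` graph_field Z'.
Proof. by move=> ZZ' a [c /ZZ' ?]; exists c. Qed.

Lemma pairing_graph_bigcup (K : Type) (F : set (set (K * K * K))) :
  F `<=` @pairing_graph K -> total_on F subset ->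
  pairing_graph (\bigcup_(Z in F) Z).
Proof.
move=> FP Ftot.
have common Z Z' : F Z -> F Z' ->
    exists Y, [/\ F Y, Z `<=` Y & Z' `<=` Y].
  move=> FZ FZ'; have [ZZ'|Z'Z] := Ftot _ _ FZ FZ'.
    by exists Z'; split=> // ?.
  by exists Z; split=> // ?.
split.
- move=> a b c [Z FZ Zabc].
  have sub : graph_field Z `<=` graph_field (\bigcup_(Z in F) Z).
    by apply: graph_field_sub; exact: bigcup_sup.
  by have [fld _ _] := FP _ FZ; case: (fld _ _ _ Zabc); split; exact: sub.
- move=> a b [c [Z FZ Zac]] [d [Z' FZ' Zbd]].
  have [Y [FY ZY Z'Y]] := common _ _ FZ FZ'; have [_ tot _] := FP _ FY.
  have [||e Ye] := tot a b; first by exists c; exact: ZY.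
    by exists d; exact: Z'Y.
  by exists e; exists Y.
- move=> p q c [Z FZ Zp] [Z' FZ' Zq].
  have [Y [FY ZY Z'Y]] := common _ _ FZ FZ'; have [_ _] := FP _ FY.
  by apply; [exact: ZY Zp|exact: Z'Y Zq].
Qed.

(** Adjoining a disjoint copy [range i] of [N] to the field creates new pairs.
The map [c] codes their components in [N], [q] merges the two codes, and [i]
takes the result into the fresh part, where no old value lies. *)
Lemma pairing_graph_extend (K : Type) (Z : set (K * K * K)) (N : Type) (n0 : N)
    (q : N * N -> N) (i : N -> K) (c : K -> N) :
  pairing_graph Z -> injective q -> injective i ->
  (forall n, ~ graph_field Z (i n)) ->
  {in graph_field Z `|` range i &, injective c} ->
  exists2 Z', Z `<` Z' & pairing_graph Z'.
Proof.
move=> [fld tot injZ] qinj iinj disj cinj.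
pose S := graph_field Z; pose U := S `|` range i.
pose new : set (K * K * K) := [set t | [/\ U t.1.1, U t.1.2,
  ~ (S t.1.1 /\ S t.1.2) & t.2 = i (q (c t.1.1, c t.1.2))]].
have fldE : graph_field (Z `|` new) = U.
  apply/seteqP; split=> a.
    by move=> [d [/fld[]|[]]] //; left.
  have [[d Zd] _|nSa Ua] := pselect (S a); first by exists d; left.
  by exists (i (q (c a, c a))); right; split=> // -[].
exists (Z `|` new); last (rewrite /pairing_graph fldE; split).
- split; first exact: subsetUl.
  have Un0 : U (i n0) by right; exists n0.
  have nSS : ~ (S (i n0) /\ S (i n0)) by case=> /disj.
  move=> /(_ (i n0, i n0, i (q (c (i n0), c (i n0))))) sub.
  by have /fld[/disj] := sub (or_intror (And4 Un0 Un0 nSS erefl)).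
- move=> a b d [/fld[? ? ?]|[/= ? ? _ ->]]; first by split; left.
  by split=> //; right; eexists.
- move=> a b Ua Ub; have [[Sa Sb]|nS] := pselect (S a /\ S b).
    by have [d Zd] := tot a b Sa Sb; exists d; left.
  by exists (i (q (c a, c b))); right.
- move=> [a b] [a' b'] d [Zp|[/= Ua Ub nS ->]] [Zq|[/= Ua' Ub' nS' dE]].
  + exact: injZ Zp Zq.
  + by have [_ _] := fld _ _ _ Zp; rewrite dE => /disj.
  + by have [_ _ /disj] := fld _ _ _ Zq.
  + have [ea eb] := qinj _ _ (iinj _ _ dE).
    by congr pair; apply: cinj; rewrite ?inE.
Qed.

(** The distinct tags [n0] and [n1] keep the values on [S] apart from those
on the rest of [T]. *)
Lemma injective_on_setU (K N : Type) (q : N * N -> N) (n0 n1 : N) (S T : set K)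
    (v r : K -> N) :
  injective q -> n0 <> n1 -> {in S &, injective v} -> {in T &, injective r} ->
  exists c : K -> N, {in S `|` T &, injective c}.
Proof.
move=> qinj n01 vinj rinj.
exists (fun a => if a \in S then q (n0, v a) else q (n1, r a)) => a b.
rewrite !in_setU.
case: ifPn => Sa /= Ta; case: ifPn => Sb /= Tb /qinj[].
- by move=> /vinj; exact.
- by move=> /n01.
- by move=> /esym/n01.
- by move=> /rinj; exact.
Qed.

(** The field [S] of a maximal pairing graph has the cardinality of [K].  A
finite [S] could be enlarged by a countable set, and so [S] is infinite.  If
the complement of [S] contained a copy of [S], [S] could be enlarged by that
copy.  Therefore the complement embeds in [S], and then so does [K], as two
copies of [S] embed in the square of [S]. *)
Lemma infinite_pairing (K : Type) : infinite_set [set: K] ->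
  exists p : K * K -> K, injective p.
Proof.
move=> infK; have [Z [PZ Zmax]] := Zorn_bigcup (@pairing_graph_bigcup K).
have {Zmax} noext N (n0 : N) (q : N * N -> N) (i : N -> K) (c : K -> N) :
    injective q -> injective i -> (forall n, ~ graph_field Z (i n)) ->
    {in graph_field Z `|` range i &, injective c} -> False.
  by move=> qI iI disj cI;
    have [Z' ZZ' /(Zmax _ ZZ')] := pairing_graph_extend n0 PZ qI iI disj cI.
have [_ tot Zinj] := PZ.
set S := graph_field Z in tot noext.
pose N := set_type S; pose M := set_type (~` S).
have Mval (m : M) : ~ S (val m) by exact: (set_mem (valP m)).
have inv_inj (D : Type) (j : D -> K) (d0 : D) : injective j ->
    exists r : K -> D, {in range j &, injective r}.
  move=> jinj; have /choice[r rP] a : exists d, range j a -> j d = a.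
    have [[d _ <-]|nja] := pselect (range j a); first by exists d.
    by exists d0.
  by exists r => a b; rewrite !inE => /rP ea /rP eb e; rewrite -ea -eb e.
have [finS|infS] := pselect (finite_set S).
  have [h hinj] : exists h : nat -> M, injective h.
    apply/card_leTT; rewrite (card_le_eqr (card_setT (~` S))).
    by apply/infiniteP/cofinite_set_infinite => //; rewrite setCK.
  have qinj : injective (@choice.pickle (nat * nat)%type).
    exact: (pcan_inj choice.pickleK).
  have /countable_injP[v vinj] := finite_set_countable finS.
  have iinj : injective (val \o h) by move=> m n /val_inj/hinj.
  have [r rinj] := inv_inj _ _ 0 iinj.
  have [c cinj] := injective_on_setU qinj (@n_Sn 0) vinj rinj.
  by have := noext nat 0 _ _ _ qinj iinj (fun n => Mval (h n)) cinj.
have [h hinj] : exists h : nat -> N, injective h.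
  by apply/card_leTT; rewrite (card_le_eqr (card_setT S)); exact/infiniteP.
have [f finj] : exists f : N * N -> N, injective f.
  have /choice[f fP] (p : N * N) : exists c : N, Z (val p.1, val p.2, val c).
    have [c Zc] := tot _ _ (set_mem (valP p.1)) (set_mem (valP p.2)).
    have [fld _ _] := PZ; have [_ _ Sc] := fld _ _ _ Zc.
    by exists (SigSub (mem_set Sc)).
  exists f => -[a b] [a' b'] e; have := fP (a', b'); rewrite -e.
  by move/(Zinj _ _ _ (fP (a, b))) => [/val_inj-> /val_inj->].
have h01 : h 0 <> h 1 by move=> /hinj.
have [v vinj] := inv_inj N val (h 0) val_inj.
have {}vinj : {in S &, injective v}.
  move=> a b Sa Sb; apply: vinj; rewrite inE.
    by exists (SigSub Sa).
  by exists (SigSub Sb).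
have [/card_leTT[d dinj]|/card_leTT[i iinj]] := card_le_total M N.
  pose r a := if pselect (~ S a) is left nSa
    then d (SigSub (@mem_set _ (~` S) a nSa)) else h 0.
  have rinj : {in ~` S &, injective r}.
    move=> a b; rewrite !inE /r.
    case: pselect => // nSa _; case: pselect => // nSb _.
    by move=> /dinj[].
  have [c] := injective_on_setU finj h01 vinj rinj.
  rewrite setUv => cinj.
  exists (fun p => val (f (c p.1, c p.2))) => -[a b] [a' b'] /val_inj/finj[].
  by move=> ea eb; congr pair; apply: cinj; rewrite ?inE.
exfalso; have jinj : injective (val \o i) by move=> m n /val_inj/iinj.
have [r rinj] := inv_inj _ _ (h 0) jinj.
have [c cinj] := injective_on_setU finj h01 vinj rinj.
exact: noext N (h 0) _ _ _ finj jinj (fun n => Mval (i n)) cinj.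
Qed.

(** The length and the iterated pairing of the entries determine a sequence. *)
Lemma infinite_seq_inj (K : Type) : infinite_set [set: K] ->
  exists e : seq K -> K, injective e.
Proof.
move=> infK; have [p pinj] := infinite_pairing infK.
have /card_leTT[i iinj] : [set: nat] #<= [set: K] by exact/infiniteP.
exists (fun s => p (i (size s), foldr (fun a b => p (a, b)) (i 0) s)).
move=> s t /pinj[/iinj + e].
elim: s t e => [|a s IHs] [|b t] //= /pinj[-> e] [st].
by rewrite (IHs t).
Qed.

(** * Sets closed under small families *)

Lemma set_inj_le (S T : Type) (f : S -> T) : injective f ->
  [set: set S] #<= [set: set T].
Proof.
move=> finj; apply/card_leTT; exists (fun A => f @` A) => A B /= AB.
by apply/funext => a; rewrite -(image_inj finj) AB image_inj.
Qed.

Inductive tree (L I : Type) : Type :=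
  | leaf
  | node of L & (I -> tree L I).
Arguments leaf {L I}.

(** A tree as the set of pairs of a position, that is the path leading there
from the root, and an element of the code of its label.  The element [None] is
present at every node; it distinguishes a leaf from a node whose label has an
empty code. *)
Fixpoint tree_code (L S I : Type) (lbl : L -> set S) (t : tree L I) :
    set (seq I * option S) :=
  match t with
  | leaf => set0
  | node l f => [set w | match w.1 with
      | [::] => oapp (lbl l) True w.2
      | i :: s => tree_code lbl (f i) (s, w.2)
      end]
  end.

Lemma tree_code_inj (L S I : Type) (lbl : L -> set S) :
  injective lbl -> injective (@tree_code L S I lbl).
Proof.
move=> lblinj; elim=> [|l f IHf] [|m g] //= e.
- by have : set0 (@nil I, @None S) by rewrite e.
- by have : set0 (@nil I, @None S) by rewrite -e.
congr node.
- apply: lblinj; apply/funext => s.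
  exact: (congr1 (fun C => C ([::], Some s)) e).
- apply/funext => i; apply: IHf; apply/funext => -[s o].
  exact: (congr1 (fun C => C (i :: s, o)) e).
Qed.

(** Codes of trees are sets of finite sequences from [K], up to injection, and
there are no more of these than sets in [K]. *)
Lemma tree_card_le (L K : Type) : infinite_set [set: K] ->
  [set: L] #<= [set: set K] -> [set: tree L K] #<= [set: set K].
Proof.
move=> infK /card_leTT[lbl lblinj].
apply: (@card_le_trans _ _ _ [set: set (seq K * option K)]).
  by apply/card_leTT; exists (@tree_code L K K lbl); exact: tree_code_inj.
have [p pinj] := infinite_pairing infK.
have [e einj] := infinite_seq_inj infK.
apply: (@set_inj_le _ _ (fun w => p (e w.1, e (seq_of_opt w.2)))).
by move=> [s o] [t o'] /= /pinj[/einj-> /einj/(can_inj seq_of_optK)->].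
Qed.

(** A demand [l] posed by a family [g] of points of [A] asks for a point of
[P l g]; a choice function answers all demands that can be met, and [A] is the
set of values of the trees under this function.  It is closed because the
children of a node can be any [K]-indexed family of trees. *)
Lemma small_closed_set (L K X : Type) (P : L -> (K -> X) -> set X) (x0 : X) :
  infinite_set [set: K] -> [set: L] #<= [set: set K] ->
  exists A : set X, [/\ A x0, A #<= [set: set K] &
    forall l g, range g `<=` A -> P l g !=set0 -> A `&` P l g !=set0].
Proof.
move=> infK LK.
have /choice[op opP] (lg : L * (K -> X)) :
    exists x, P lg.1 lg.2 !=set0 -> P lg.1 lg.2 x.
  by have [[x Px]|nP] := pselect (P lg.1 lg.2 !=set0); [exists x|exists x0].
pose fix eval (t : tree L K) : X :=
  match t with leaf => x0 | node l f => op (l, fun k => eval (f k)) end.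
exists (range eval); split; first by exists leaf.
  apply: card_le_trans (tree_card_le infK LK).
  exact: card_image_le.
move=> l g gA Plg0.
have /choice[f fP] k : exists t, eval t = g k.
  by have [t _ <-] := gA _ (imageT g k); exists t.
exists (op (l, g)); split; last exact: (opP (l, g)).
by exists (node l f) => //=; congr (op (l, _)); apply/funext.
Qed.

(** Families indexed by any type that embeds in [K] can thus pose demands:
the indices outside the range of [f] get the value [x0]. *)
Lemma injective_extension (D K X : Type) (f : D -> K) (h : D -> X) (A : set X)
    (x0 : X) :
  injective f -> A x0 -> range h `<=` A ->
  exists g : K -> X, range g `<=` A /\ forall d, g (f d) = h d.
Proof.
move=> finj Ax0 hA.
have /choice[g gP] k : exists x, A x /\ forall d, f d = k -> x = h d.
  have [[d _ <-]|nk] := pselect (range f k).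
    by exists (h d); split=> [|c /finj->//]; exact: hA.
  by exists x0; split=> // d fd; case: nk; exists d.
exists g; split=> [_ [k _ <-]|d]; first by have [] := gP k.
by have [_ gd] := gP (f d); exact: gd.
Qed.

(** * Nets, covers and the missing point *)

(** A base with fewer sets than [K] is padded with the whole space. *)
Lemma indexed_local_base (X : topologicalType) (K : Type) :
  bounds_character X K ->
  exists N : X -> K -> set X,
    (forall x k, open_nbhs x (N x k)) /\
    (forall x U, nbhs x U -> exists k, N x k `<=` U).
Proof.
move=> [_ base].
suff /choice[N NP] x : exists N : K -> set X, (forall k, open_nbhs x (N k)) /\
    forall U, nbhs x U -> exists k, N k `<=` U.
  by exists N; split=> [x k|x U]; have [] := NP x; auto.
have [B [Bx Bbase] BK] := base x.
have /card_leTT[f finj] : [set: set_type B] #<= [set: K].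
  by rewrite (card_le_eql (card_setT B)).
have BT : open_nbhs x setT by split=> //; exact: openT.
have Bopen : range (val : B -> set X) `<=` open_nbhs x.
  by move=> _ [b _ <-]; apply: Bx; exact: set_mem (valP b).
have [N [NB Nf]] := injective_extension finj BT Bopen.
exists N; split=> [k|U /Bbase[V BV VU]]; first by apply: NB; exists k.
by exists (f (SigSub (mem_set BV))); rewrite Nf.
Qed.

(** A theta-cluster point in [X] of a net in [A] that lies in [A] is one
relative to [A]: neighbourhoods of [x] and of a value of the net that meet do
so inside [A]. *)
Lemma chi_net_closed_of_meets (X : topologicalType)
    (N : X -> chi X -> set X) (A : set X) :
  (forall x k, open_nbhs x (N x k)) ->
  (forall x U, nbhs x U -> exists k, N x k `<=` U) ->
  (forall x y k l, A x -> A y -> N x k `&` N y l !=set0 ->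
     A `&` (N x k `&` N y l) !=set0) ->
  (forall xi : net (chi X) X, net_in xi A ->
     theta_cluster_point [set: X] xi !=set0 ->
     A `&` theta_cluster_point [set: X] xi !=set0) ->
  chi_net_closed A.
Proof.
move=> Nopen Nbase meetA clusterA xi xiA /(clusterA _ xiA)[x [Ax [_ clx]]].
exists x; split=> // U openU Ux alpha.
have [k kU] := Nbase x U (open_nbhs_nbhs (conj openU Ux)).
have [openk xk] := Nopen x k.
have [F [alphaF clF]] := clx _ openk xk alpha; exists F.
split=> // B /Nbase[l lB].
have : N x k `&` N (xi F) l !=set0.
  by have := clF _ (open_nbhs_nbhs (Nopen (xi F) l)); rewrite setIT.
move=> /(meetA _ _ _ _ Ax (xiA F))[y [Ay [ky ly]]].
by exists y; split; [split; [exact: kU|]|exact: lB].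
Qed.

(** The [alpha]-th subcollection of the cover consists of the basic sets
disjoint from [N q alpha], so that no closure of a union within it can reach
[q]. *)
Lemma basic_cover_missing (X : topologicalType) (N : X -> chi X -> set X)
    (A : set X) (q : X) :
  hausdorff_space X -> chi_Lindelof X ->
  (forall x k, open_nbhs x (N x k)) ->
  (forall x U, nbhs x U -> exists k, N x k `<=` U) ->
  chi_net_closed A -> ~ A q ->
  exists V : chi X -> set (set X),
    [/\ forall alpha, countable (V alpha),
        forall alpha O, V alpha O -> exists x k, A x /\ N x k = O,
        A `<=` \bigcup_alpha closure (\bigcup_(O in V alpha) O)
      & ~ (\bigcup_alpha closure (\bigcup_(O in V alpha) O)) q].
Proof.
move=> hX hL Nopen Nbase Aclosed nAq.
pose U (alpha : chi X) : set (set X) :=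
  [set O | (exists x k, A x /\ N x k = O) /\ O `&` N q alpha = set0].
have [|x Ax|V [VU AV]] := hL A Aclosed U.
- by move=> alpha _ [[x [k [_ <-]]] _]; have [] := Nopen x k.
- have xq : x != q by apply/eqP => xq; apply: nAq; rewrite -xq.
  move: hX; rewrite open_hausdorff => /(_ _ _ xq)[[O W] /= [xO qW]].
  move=> [openO openW /eqP OW].
  have [k kO] := Nbase x O (open_nbhs_nbhs (conj openO (set_mem xO))).
  have [l lW] := Nbase q W (open_nbhs_nbhs (conj openW (set_mem qW))).
  exists l => //; exists (N x k); last by have [] := Nopen x k.
  split; first by exists x, k.
  by rewrite -subset0 => y [/kO Oy /lW Wy]; rewrite -OW.
exists V; split=> [alpha|alpha O||] //; first by have [] := VU alpha.
  by have [VU' _] := VU alpha => /VU'[].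
move=> [alpha _ /(_ _ (open_nbhs_nbhs (Nopen q alpha)))[y [[O VO Oy] qy]]].
have [VU' _] := VU alpha; have [_ OE] := VU' _ VO.
by have : set0 y by rewrite -OE.
Qed.

(** [Cluster] asks for a theta-cluster point of the net that the family [g]
encodes, [Meet k l] for a point common to the [k]-th and [l]-th basic
neighbourhoods of two designated members of [g].  [Escape R] asks for a point
outside all the closures of unions of subcollections, where the triple
[(alpha, b, k)] in [R] puts the [k]-th basic neighbourhood of [g b] into the
[alpha]-th subcollection. *)
Inductive demand (K : Type) : Type :=
  | Cluster
  | Meet of K & K
  | Escape of set (K * K * K).
Arguments Cluster {K}.

(** The lengths of the sequences tell the constructors apart; the sequences of
length one do so for [Escape set0]. *)
Lemma demand_card_le (K : Type) : infinite_set [set: K] ->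
  [set: demand K] #<= [set: set K].
Proof.
move=> infK; have [e einj] := infinite_seq_inj infK.
apply: card_le_trans (set_inj_le einj).
have [k0 _] := infinite_setN0 infK.
apply/card_leTT; exists (fun d : demand K => match d return set (seq K) with
  | Cluster => set0
  | Meet k l => [set [:: k; l]]
  | Escape R => [set s | match s with
      | [:: _] => True | [:: a; b; c] => R (a, b, c) | _ => False end]
  end).
move=> [|k l|R] [|k' l'|R'] //= E.
- by have : [set [:: k'; l']] [:: k'; l'] by []; rewrite -E.
- by have : @set0 (seq K) [:: k0] by rewrite E.
- by have : [set [:: k; l]] [:: k; l] by []; rewrite E.
- have : [set [:: k'; l']] [:: k; l] by rewrite -E.
  by move=> [-> ->].
- by have : [set [:: k; l]] [:: k0] by rewrite E.
- by have : @set0 (seq K) [:: k0] by rewrite -E.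
- by have : [set [:: k'; l']] [:: k0] by rewrite -E.
congr Escape; apply/funext => -[[a b] c].
exact: (congr1 (fun T => T [:: a; b; c]) E).
Qed.

Theorem theorem11 (X : topologicalType) (hX : hausdorff_space X)
    (hL : chi_Lindelof X) :
  [set: X] #<= [set: set (chi X)].
Proof.
have [[infK baseK] _] := chiP X; pose K := chi X.
have [N [Nopen Nbase]] := indexed_local_base (conj infK baseK).
have [p pinj] := infinite_pairing infK.
have [e einj] := infinite_seq_inj infK.
have /card_leTT[i iinj] : [set: nat] #<= [set: K] by exact/infiniteP.
have [XE|/set0P[x0 _]] := eqVneq [set: X] set0; first by rewrite XE card_ge0.
pose enumF (F : {fset K}) := e (enum_fset F).
have enumF_inj : injective enumF.
  by move=> F G /einj FG; exact: val_inj.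
pose P (d : demand K) (g : K -> X) : set X := match d with
  | Cluster => theta_cluster_point [set: X] (fun F : {fset K} => g (enumF F))
  | Meet k l => N (g (i 0)) k `&` N (g (i 1)) l
  | Escape R => ~` \bigcup_alpha closure
      (\bigcup_(bk in [set bk | R (alpha, bk.1, bk.2)]) N (g bk.1) bk.2)
  end.
have [A [Ax0 AK Aclosed]] :=
  small_closed_set P x0 infK (demand_card_le infK).
suff <- : A = [set: X] by [].
have Anet : chi_net_closed A.
  apply: chi_net_closed_of_meets Nopen Nbase _ _.
    move=> x y k l Ax Ay xy.
    have iinj' : injective (fun b : bool => i b) by move=> [] [] /iinj.
    have xyA : range (fun b : bool => if b then y else x) `<=` A.
      by move=> _ [[] _ <-].
    have [g [gA gE]] := injective_extension iinj' Ax0 xyA.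
    have := Aclosed (Meet k l) g gA.
    by rewrite /P (gE false) (gE true); exact.
  move=> xi xiA; have xirA : range xi `<=` A by move=> _ [F _ <-].
  have [g [gA gE]] := injective_extension enumF_inj Ax0 xirA.
  have := Aclosed Cluster g gA; rewrite /P.
  by have -> : (fun F => g (enumF F)) = xi by exact/funext.
apply/seteqP; split=> // q _; apply: contrapT => nAq.
have [V [Vcount VN AV Vq]] := basic_cover_missing hX hL Nopen Nbase Anet nAq.
(* The selected sets, kept apart according to the index of their subcollection,
   are at most kappa * omega = kappa many: [f] numbers them by [K]. *)
pose D := {alpha : K & set_type (V alpha)}.
have /choice[c cP] (d : D) :
    exists xk : X * K, A xk.1 /\ N xk.1 xk.2 = val (tagged d).
  by have [x [k xk]] := VN _ _ (set_mem (valP (tagged d))); exists (x, k).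
have /choice[v vP] alpha :
    exists v : set X -> nat, {in V alpha &, injective v}.
  exact/countable_injP/Vcount.
pose f (d : D) := p (tag d, i (v (tag d) (val (tagged d)))).
have finj : injective f.
  move=> [a O] [b O'] /pinj[/= ab] /iinj; case: b / ab O' => O' vO.
  by congr existT; apply: val_inj; apply: vP vO; exact: valP.
have cA : range (fun d => (c d).1) `<=` A by move=> _ [d _ <-]; have [] := cP d.
have [g [gA gE]] := injective_extension finj Ax0 cA.
pose R : set (K * K * K) := [set t | exists d,
  [/\ tag d = t.1.1, f d = t.1.2 & (c d).2 = t.2]].
have RV alpha :
    \bigcup_(bk in [set bk | R (alpha, bk.1, bk.2)]) N (g bk.1) bk.2 =
    \bigcup_(O in V alpha) O.
  apply/seteqP; split=> y.
    move=> [[_ _] [d /= [<- <- <-]]]; rewrite gE; have [_ ->] := cP d => dy.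
    by exists (val (tagged d)) => //; exact: set_mem (valP (tagged d)).
  move=> [O VO Oy]; pose d : D := existT _ alpha (SigSub (mem_set VO)).
  exists (f d, (c d).2); first by exists d.
  by rewrite /= gE; have [_ ->] := cP d.
have PE : P (Escape R) g =
    ~` \bigcup_alpha closure (\bigcup_(O in V alpha) O).
  by rewrite /P; congr (~` _); apply: eq_bigcupr => alpha _; rewrite RV.
have [|y [Ay]] := Aclosed (Escape R) g gA; first by exists q; rewrite PE.
by rewrite PE; apply; exact: AV.
Qed.
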